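(* Let $\mathbb{F}$ be a finite field, let $k$ be a positive integer, and let $0<\varepsilon<1/20$. Then, provided $d$ is sufficiently large with respect to $k$, the following holds: if $S\subset \mathbb{F}^{d}$ satisfies $|S|\geq |\mathbb{F}|^{d(1-\varepsilon)}$, then $S$ is not $\big(k,\frac{k-\log_2(1/\varepsilon)}{8\varepsilon}\big)$-subspace evasive.
   Context: For a finite field $\mathbb{F}$, positive integers $k\le d$ and a real number $c$, a set $S\subset\mathbb{F}^d$ is called $(k,c)$-subspace evasive if every $k$-dimensional affine subspace of $\mathbb{F}^d$ contains at most $c$ elements of $S$. *)

(* Defs.v *)
From HB Require Import structures.
From mathcomp Require Import all_boot all_order all_algebra.
From mathcomp Require Import reals exp.

Set Implicit Arguments.
Unset Strict Implicit.
Unset Printing Implicit Defensive.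

Import Order.TTheory GRing.Theory Num.Theory.

Local Open Scope ring_scope.

Definition log2 (R : realType) (x : R) : R := ln x / ln 2.

Definition affine_subspace (F : finFieldType) (d k : nat)
    (A : {set 'rV[F]_d}) : Prop :=
  exists (x : 'rV[F]_d) (U : {vspace 'rV[F]_d}),
    \dim U = k /\ A = [set x + u | u in U]%SET.

(* The bound c is an arbitrary real, possibly nonpositive.  The standing
   assumption 0 < k <= d is left to the uses of this predicate; for k > d it
   holds vacuously. *)
Definition subspace_evasive (R : realType) (F : finFieldType) (d k : nat)
    (c : R) (S : {set 'rV[F]_d}) : Prop :=
  forall A : {set 'rV[F]_d},
    affine_subspace k A -> #|A :&: S|%:R <= c.

(* Main.v *)
Require Import Defs.
From HB Require Import structures.
From mathcomp Require Import all_boot all_order all_algebra.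
From mathcomp Require Import reals exp.
From mathcomp Require Import finfield zify lra.

Import Order.TTheory GRing.Theory Num.Theory.

Local Open Scope ring_scope.

(** Write q = |F| and choose j with 2^j <= 1/(2 eps) < 2^(j+1).  As in Hilbert's
    cube lemma, pass j times from a set T to T :&: (T - v) for a popular
    difference v outside the span of the earlier ones; the density is roughly
    squared each time, so it stays at least about q^(-d/2).  This yields a
    nondegenerate j-dimensional cube B and a set T with at least 2 q^k elements
    such that t + B lies in S for all t in T.  Starting from one translate of B,
    each further dimension gains a disjoint translate, because T does not fit
    in an affine space of dimension less than k.  Some k-dimensional affine space
    thus meets S in at least (k - j + 1) 2^j points. *)

Section Translates.

Variables (F : finFieldType) (d : nat).
Implicit Types (S T B : {set 'rV[F]_d}) (W U : {vspace 'rV[F]_d}).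

(** Averaging over differences: at least half of the pairs in [T] x [T] have their difference
    outside [W], and there are at most [Q] possible differences, so some [v] accounts for at least
    [#|T| ^ 2 / (2 * Q)] pairs. *)
Lemma popular_difference T W :
  (0 < #|T|)%N -> (2 * #|W| <= #|T|)%N ->
  exists2 v, v \notin W &
    (#|T| ^ 2 <= 2 * #|{: 'rV[F]_d}| * #|[set t in T | (t + v)%R \in T]|)%N.
Proof.
move=> T0 WT; set Q := #|{: 'rV[F]_d}|.
pose r v := #|[set t in T | (t + v)%R \in T]|.
case: (boolP [exists v, (v \notin W) && (#|T| ^ 2 <= 2 * Q * r v)%N]).
  by case/existsP=> v /andP[vW le]; exists v.
rewrite negb_exists => /forallP noV.
have sumE : (\sum_(v | v \notin W) r v =
    \sum_(t in T) #|[set v | (v \notin W) && ((t + v)%R \in T)]|)%N.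
  transitivity (\sum_(v | v \notin W) \sum_(t in T) ((t + v)%R \in T))%N.
    apply: eq_bigr => v _; rewrite /r -sum1_card big_mkcond /=.
    rewrite [RHS]big_mkcond /=; apply: eq_bigr => t _; rewrite inE.
    by case: (t \in T) => //=; case: (_ \in T).
  rewrite exchange_big /=; apply: eq_bigr => t _.
  rewrite -sum1_card big_mkcond /= [RHS]big_mkcond /=.
  by apply: eq_bigr => v _; rewrite inE; case: (v \in W) => //=; case: (_ \in T).
(* For each [t], exactly [#|T|] vectors [v] satisfy [t + v \in T], and at most [#|W|] of them lie in
   [W]. *)
have sum_ge : (#|T| * (#|T| - #|W|) <= \sum_(v | v \notin W) r v)%N.
  rewrite sumE -sum_nat_const; apply: leq_sum => t _.
  have -> : #|T| = #|[set v | (t + v)%R \in T]|.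
    rewrite -(card_imset [set v | (t + v)%R \in T] (addrI t)).
    apply: eq_card => y; apply/idP/imsetP => [yT|[v]].
      by exists (y - t); rewrite ?inE addrC subrK.
    by rewrite inE => vT ->.
  rewrite leq_subLR -[#|W|]cardsE.
  apply: leq_trans (leq_card_setU _ _); apply: subset_leq_card.
  by apply/subsetP => v; rewrite !inE => ->; rewrite andbT orbN.
have sum_le : (2 * Q * (\sum_(v | v \notin W) r v) <= Q * (#|T| ^ 2 - 1))%N.
  rewrite big_distrr /=.
  apply: (@leq_trans (\sum_(v : 'rV[F]_d | v \notin W) (#|T| ^ 2 - 1))%N).
    apply: leq_sum => v vW; have := noV v; rewrite vW /= -ltnNge; lia.
  by rewrite sum_nat_const leq_mul2r; apply/orP; right; exact: max_card.
have Q0 : (0 < Q)%N by apply/card_gt0P; exists 0.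
have : (Q * #|T| ^ 2 <= Q * (#|T| ^ 2 - 1))%N.
  apply: leq_trans sum_le; rewrite [(2 * Q)%N]mulnC -mulnA leq_mul2l.
  apply/orP; right; apply: leq_trans (leq_mul (leqnn 2) sum_ge).
  by rewrite mulnCA expnS expn1 leq_mul2l; apply/orP; right; lia.
rewrite leq_mul2l; case/orP => [/eqP|]; first by lia.
have : (0 < #|T| ^ 2)%N by rewrite expn_gt0 T0.
lia.
Qed.

Lemma dim_add_line W v : v \notin W -> \dim (W + <[v]>) = (\dim W).+1.
Proof.
move=> vW; have v0 : v != 0 by apply: contraNneq vW => ->; exact: mem0v.
rewrite dimv_disjoint_sum; first by rewrite dim_vline v0 addn1.
apply/eqP; rewrite -subv0; apply/subvP => x; rewrite memv_cap => /andP[xW].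
case/vlineP=> c xE; rewrite memv0; apply: contraNT vW => x0.
have c0 : c != 0 by apply: contraNneq x0 => c0; rewrite xE c0 scale0r.
by rewrite -(scalerK c0 v) -xE memvZ.
Qed.

(** Induction on [j], doubling [B] to the union of [B] and [B + v] while [T] shrinks to the [t] with
    [t] and [t + v] both in [T]. The numerical hypothesis has exactly the form that survives one
    such squaring step. *)
Lemma cube_translates S j k T B W :
  (\dim W + j <= k)%N -> {subset B <= W} ->
  {in T & B, forall t b, t + b \in S} ->
  (2 * #|F| ^ k * (2 * #|{: 'rV[F]_d}|) ^ (2 ^ j).-1 <= #|T| ^ (2 ^ j))%N ->
  exists T' B' W',
    [/\ \dim W' = (\dim W + j)%N, {subset B' <= W'},
        {in T' & B', forall t b, t + b \in S},
        #|B'| = (2 ^ j * #|B|)%N & (2 * #|F| ^ k <= #|T'|)%N].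
Proof.
have F0 : (0 < #|F|)%N by apply/card_gt0P; exists 0.
set Q := #|{: 'rV[F]_d}|.
have Q0 : (0 < Q)%N by apply/card_gt0P; exists 0.
elim: j T B W => [|j IH] T B W.
  by rewrite !expn0 expn1 muln1 mul1n !addn0 => ? ? ? ?; exists T, B, W.
move=> dimW BW TBS Tlarge.
(* All but one of the [2 ^ j.+1] factors [#|T|] are at most [2 * Q]; cancelling them leaves this
   bound, which makes [W] small enough for a popular difference to exist. *)
have Tk : (2 * #|F| ^ k <= #|T|)%N.
  have Tle : (#|T| <= 2 * Q)%N by apply: leq_trans (max_card _) (leq_pmull _ _).
  rewrite -(@leq_pmul2r ((2 * Q) ^ (2 ^ j.+1).-1)); last by rewrite expn_gt0; lia.
  apply: leq_trans Tlarge _; rewrite -[in X in (X <= _)%N](@prednK (2 ^ j.+1)).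
    by rewrite expnS leq_mul2l leq_exp2r ?Tle ?orbT // -ltnS prednK ?expn_gt0 //;
       rewrite (@leq_pexp2l 2 1).
  by rewrite expn_gt0.
have Wk : (#|W| <= #|F| ^ k)%N.
  by rewrite card_vspace leq_pexp2l //; apply: leq_trans dimW; exact: leq_addr.
have Fk0 : (0 < #|F| ^ k)%N by rewrite expn_gt0 F0.
have [|| v vW vT] := @popular_difference T W; [lia | lia |].
set T1 := [set t in T | t + v \in T] in vT.
have Bv0 : B :&: [set b + v | b in B] = set0.
  apply/setP => x; rewrite !inE; apply/negP => /andP[xB /imsetP[b bB xE]].
  case/negP: vW; rewrite -(addKr b v) -xE addrC.
  by apply: rpredB; exact: BW.
have := IH T1 (B :|: [set b + v | b in B]) (W + <[v]>)%VS.
case.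
- by rewrite dim_add_line //; lia.
- move=> x; rewrite inE => /orP[xB|/imsetP[b bB ->]].
    by apply: (subvP (addvSl _ _)); exact: BW.
  by apply: memv_add; [exact: BW | exact: memv_line].
- move=> t x; rewrite !inE => /andP[tT tvT] /orP[xB|/imsetP[b bB ->]].
    exact: TBS.
  by rewrite [b + v]addrC addrA; exact: TBS.
(* Raise [#|T| ^ 2 <= 2 * Q * #|T1|] to the power [2 ^ j]; cancelling [(2 * Q) ^ (2 ^ j)] turns the
   exponent [2 ^ j.+1 - 1] into [2 ^ j - 1]. *)
- have P0 : (0 < (2 * Q) ^ (2 ^ j))%N by rewrite expn_gt0; lia.
  have tj0 : (0 < 2 ^ j)%N by rewrite expn_gt0.
  rewrite -(leq_pmul2r P0) -expnMn [X in (_ <= X ^ _)%N]mulnC.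
  have -> : (2 * #|F| ^ k * (2 * Q) ^ (2 ^ j).-1 * (2 * Q) ^ 2 ^ j =
             2 * #|F| ^ k * (2 * Q) ^ (2 ^ j.+1).-1)%N.
    rewrite -mulnA -expnD; congr (_ * _ ^ _)%N; rewrite expnS; lia.
  apply: leq_trans Tlarge _.
  by rewrite expnS expnM leq_exp2r.
move=> T' [B' [W' [dimW' B'W' TBS' cB' cT']]].
exists T', B', W'; split=> //; first by rewrite dimW' dim_add_line //; lia.
rewrite cB' cardsU Bv0 cards0 subn0 card_imset; last exact: addIr.
by rewrite addnn -mul2n expnS mulnCA mulnA.
Qed.

(** Since [B] lies in [W] and [W] in [U], a translate [t + B] with [t] outside [x + U] misses
    [x + U] entirely, so adding the direction [t - x] gains [#|B|] new points. The initial translate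
    accounts for the extra one in [m.+1]. *)
Lemma span_translates S T B W m :
  {subset B <= W} -> {in T & B, forall t b, t + b \in S} ->
  (#|F| ^ (\dim W + m) < #|T|)%N ->
  exists x U, [/\ (W <= U)%VS, \dim U = (\dim W + m)%N &
    (m.+1 * #|B| <= #|[set (x + u)%R | u in U] :&: S|)%N].
Proof.
move=> BW TBS.
have F1 : (1 < #|F|)%N by exact: card_finNzRing_gt1.
elim: m => [|m IH] cT.
  have /card_gt0P[x xT] : (0 < #|T|)%N by lia.
  exists x, W; split; rewrite ?addn0 // mul1n -(card_imset B (addrI x)).
  apply: subset_leq_card; apply/subsetP => _ /imsetP[b bB ->].
  by rewrite inE TBS // andbT; apply/imsetP; exists b => //; exact: BW.
case: IH => [|x [U [WU dimU cU]]].
  by apply: leq_ltn_trans cT; rewrite leq_exp2l //; lia.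
have [t tT tU] : exists2 t, t \in T & t - x \notin U.
  case: (boolP [exists t, (t \in T) && (t - x \notin U)]).
    by case/existsP=> t /andP[]; exists t.
  rewrite negb_exists => /forallP noT; exfalso.
  move: cT; rewrite ltnNge; case/negP.
  apply: (@leq_trans #|[set x + u | u in U]|); last first.
    apply: leq_trans (leq_imset_card _ _) _.
    by rewrite card_vspace dimU leq_exp2l //; lia.
  apply: subset_leq_card; apply/subsetP => t tT.
  move: (noT t); rewrite tT negbK => tU.
  by apply/imsetP; exists (t - x); rewrite // addrC subrK.
exists x, (U + <[t - x]>)%VS; split.
- exact: subv_trans WU (addvSl _ _).
- by rewrite dim_add_line // dimU addnS.
have disj : ([set x + u | u in U] :&: S) :&: [set t + b | b in B] = set0.
  apply/setP => y; rewrite !inE; apply/negP.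
  case/andP => /andP[/imsetP[u uU yE] _] /imsetP[b bB yE'].
  case/negP: tU; suff -> : t - x = u - b.
    by apply: rpredB => //; apply: (subvP WU); exact: BW.
  apply: (addIr (x + b)); rewrite addrA subrK.
  by rewrite -yE' yE [x + b]addrC addrA subrK addrC.
apply: (@leq_trans #|([set x + u | u in U] :&: S) :|: [set t + b | b in B]|).
  rewrite cardsU disj cards0 subn0 card_imset; last exact: addrI.
  by rewrite [(m.+2 * _)%N]mulSn addnC leq_add2r.
apply: subset_leq_card; apply/subsetP => y; rewrite !inE.
case/orP => [/andP[/imsetP[u uU ->] ->]|/imsetP[b bB ->]].
  by rewrite andbT; apply/imsetP; exists u; rewrite //; apply: (subvP (addvSl _ _)).
rewrite TBS // andbT; apply/imsetP; exists (b + (t - x)).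
  by apply: memv_add; [apply: (subvP WU); exact: BW | exact: memv_line].
by rewrite addrCA [x + _]addrC subrK addrC.
Qed.

Lemma rich_affine_subspace S j k :
  (j <= k)%N ->
  (2 * #|F| ^ k * (2 * #|F| ^ d) ^ (2 ^ j).-1 <= #|S| ^ (2 ^ j))%N ->
  exists2 A, affine_subspace k A & ((k - j).+1 * 2 ^ j <= #|A :&: S|)%N.
Proof.
move=> jk cS.
have cQ : #|{: 'rV[F]_d}| = (#|F| ^ d)%N by rewrite card_mx mul1n.
have F0 : (0 < #|F|)%N by apply/card_gt0P; exists 0.
case: (@cube_translates S j k S [set 0] 0%VS).
- by rewrite dimv0.
- by move=> x; rewrite inE => /eqP ->; exact: mem0v.
- by move=> t b tS; rewrite inE => /eqP ->; rewrite addr0.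
- by rewrite cQ.
move=> T [B [W [dimW BW TBS cB cT]]].
rewrite dimv0 add0n in dimW; rewrite cards1 muln1 in cB.
(* The factor 2 in [2 * #|F| ^ k <= #|T|] supplies the strict inequality required here. *)
have [|x [U [_ dimU cU]]] := @span_translates S T B W (k - j) BW TBS.
  rewrite dimW subnKC //; apply: leq_trans cT.
  by have : (0 < #|F| ^ k)%N by [rewrite expn_gt0 F0]; lia.
exists [set x + u | u in U]; last by rewrite -cB.
by exists x, U; rewrite dimU dimW subnKC.
Qed.

End Translates.

(** Bounding each factor 2 by [q] reduces the claim to [2 ^ j + k <= d * (1 - 2 ^ j * eps)]. The
    right side is at least [d / 2], and [j <= k] bounds the left side by [2 ^ k + k]. *)
Lemma dense_pow_ge (R : realType) (eps : R) (q d j k s : nat) :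
  (1 < q)%N -> 0 < eps -> (2 ^ j)%:R * eps <= 1 / 2 -> (j <= k)%N ->
  (2 * (2 ^ k + k) <= d)%N -> (q%:R : R) `^ (d%:R * (1 - eps)) <= s%:R ->
  (2 * q ^ k * (2 * q ^ d) ^ (2 ^ j).-1 <= s ^ (2 ^ j))%N.
Proof.
move=> q1 e0 je jk dk sq.
have tj0 : (0 < 2 ^ j)%N by rewrite expn_gt0.
have tjk : (2 ^ j <= 2 ^ k)%N by rewrite leq_exp2l.
apply: (@leq_trans (q ^ (2 ^ j + k + d * (2 ^ j).-1))%N).
  rewrite expnMn mulnACA -expnS prednK // -expnM -expnD -addnA [leqRHS]expnD.
  by rewrite leq_mul2r leq_exp2r // q1 orbT.
rewrite -(@ler_nat R) !natrX.
have q0 : (0 : R) < q%:R by rewrite ltr0n; lia.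
apply: (@le_trans _ _ (((q%:R : R) `^ (d%:R * (1 - eps))) ^+ (2 ^ j))); last first.
  by rewrite lerXn2r // ?nnegrE ?powR_ge0 ?ler0n.
rewrite -!powR_mulrn ?powR_ge0 ?ler0n // -powRrM.
apply: ler_powR; first by rewrite ler1n; lia.
rewrite !natrD natrM -subn1 natrB //.
have h1 : (2 : R) * ((2 ^ j)%:R + k%:R) <= d%:R.
  by rewrite -natrD -natrM ler_nat; lia.
have d0 : (0 : R) <= d%:R by [].
nra.
Qed.

Lemma pow2_between (R : realType) (x : R) :
  1 <= x -> exists j : nat, (2 ^ j)%:R <= x < (2 ^ j.+1)%:R.
Proof.
move=> x1; have x0 : 0 <= x by lra.
have /andP[n1 n2] := truncn_itv x0.
set n := Num.truncn x in n1 n2.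
have n0 : (0 < n)%N by rewrite truncn_gt0.
have /andP[l1 l2] := trunc_log_bounds (isT : 1 < 2)%N n0.
exists (trunc_log 2 n); apply/andP; split.
  by apply: le_trans n1; rewrite ler_nat.
by apply: lt_le_trans n2 _; rewrite ler_nat.
Qed.

Theorem theorem1p1 (R : realType) (k : nat) (k_gt0 : (0 < k)%N) :
  exists d0 : nat,
    forall (F : finFieldType) (eps : R) (d : nat),
      0 < eps -> eps < 1 / 20 -> (d0 <= d)%N ->
      forall S : {set 'rV[F]_d},
        (#|F|%:R : R) `^ (d%:R * (1 - eps)) <= #|S|%:R ->
        ~ subspace_evasive k ((k%:R - log2 (1 / eps)) / (8 * eps)) S.
Proof.
(* Using [2 ^ k] instead of [2 ^ j] keeps the threshold independent of [eps]. *)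
exists (2 * (2 ^ k + k))%N => F eps d e0 e20 dk S cS evS.
have q1 : (1 < #|F|)%N by exact: card_finNzRing_gt1.
suff [j [jk je lt_c]] : exists j : nat, [/\ (j <= k)%N, (2 ^ j)%:R * eps <= 1 / 2 &
    (k%:R - log2 (1 / eps)) / (8 * eps) < ((k - j).+1 * 2 ^ j)%:R :> R].
  have [A kA cA] := @rich_affine_subspace F d S j k jk
    (@dense_pow_ge R eps #|F| d j k #|S| q1 e0 je jk dk cS).
  have := lt_le_trans lt_c (le_trans _ (evS A kA)).
  by rewrite ler_nat cA => /(_ isT); rewrite ltxx.
(* If [k <= log2 (1 / eps)], the evasiveness bound is nonpositive and [j = 0] suffices. *)
have [kL|Lk] := leP (k%:R : R) (log2 (1 / eps)).
  exists 0%N; split=> //; first by rewrite expn0 mul1r; lra.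
  rewrite expn0 muln1 subn0; apply: (@le_lt_trans _ _ 0); last by rewrite ltr0n.
  by rewrite ler_pdivrMr ?mul0r ?subr_le0 //; lra.
have [|j /andP[j1 j2]] := @pow2_between R (1 / (2 * eps)).
  by rewrite ler_pdivlMr; lra.
have je : (2 ^ j)%:R * eps <= 1 / 2.
  by move: j1; rewrite ler_pdivlMr; lra.
have je' : 1 / 4 < (2 ^ j)%:R * eps.
  by move: j2; rewrite ltr_pdivrMr ?expnS ?natrM; lra.
have ln2 : 0 < ln (2 : R) by apply: ln_gt0; lra.
(* From [2 ^ j.+1 <= 1 / eps]; with [Lk] this gives [j + 1 < k]. *)
have jL : j%:R + 1 <= log2 (1 / eps).
  rewrite /log2 ler_pdivlMr // natr1 mulr_natl -lnXn; last by lra.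
  rewrite ler_ln ?posrE ?exprn_gt0 ?divr_gt0 //; try lra.
  by rewrite ler_pdivlMr // -natrX expnS natrM; lra.
have jk : (j <= k)%N by rewrite -(ler_nat R); lra.
exists j; split=> //.
(* As [8 * eps * 2 ^ j > 2], the right side exceeds [2 * (k - j + 1)], while [jL] bounds the left
   side by [k - j - 1]. *)
rewrite ltr_pdivrMr; last by lra.
rewrite natrM -natr1 natrB //.
nra.
Qed.
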